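(* Let $\delta=[\delta_1,\delta_2]\in\mathbb{D}$ with $\delta_1>0$. Then the unit distance problem in the dual plane $\mathbb{D}^2$ is equivalent to finding the maximum number of times that an $n$-point set can span the distance $\delta$: for every $n\ge 1$, the maximum, over all sets $\mathcal{P}\subset\mathbb{D}^2$ of $n$ points, of the number of pairs $p,q\in\mathcal{P}$ with $\rho_{\mathbb{D}^2}(p,q)=[1,0]$ equals the maximum, over all sets $\mathcal{P}\subset\mathbb{D}^2$ of $n$ points, of the number of pairs $p,q\in\mathcal{P}$ with $\rho_{\mathbb{D}^2}(p,q)=\delta$. In particular, the unit distance bound holds for every non-zero repeated distance: there is an absolute constant $C$ such that for every such $\delta$, every $0\le\lambda\le 1$, and every set $\mathcal{P}$ of $n$ points in $\mathbb{D}^2$ with multiplicity $n^{\lambda}$, the number of pairs $p,q\in\mathcal{P}$ with $\rho_{\mathbb{D}^2}(p,q)=\delta$ is at most $C\left(n^{1+\lambda}\log^4 n+n^{4/3}\log^2 n\right)$.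
   Context: The dual numbers $\mathbb{D}$ are the two-dimensional unital associative $\mathbb{R}$-algebra obtained by adjoining to $\mathbb{R}$ an element $\varepsilon$ with $\varepsilon^2=0$. Each dual number is uniquely $x+y\varepsilon$ with $x,y\in\mathbb{R}$, and is denoted $[x,y]$. A point $(x+y\varepsilon,z+w\varepsilon)\in\mathbb{D}^2$ is denoted $[x,y,z,w]$; its real part is $(x,z)\in\mathbb{R}^2$ and its imaginary part is $(y,w)\in\mathbb{R}^2$. The distance function $\rho_{\mathbb{D}^2}:\mathbb{D}^2\times\mathbb{D}^2\to\mathbb{D}$ is \[\rho_{\mathbb{D}^2}([x,y,z,w],[x',y',z',w'])=\big((x+y\varepsilon)-(x'+y'\varepsilon)\big)^2+\big((z+w\varepsilon)-(z'+w'\varepsilon)\big)^2,\] which equals $[(x-x')^2+(z-z')^2,\ 2((x-x')(y-y')+(z-z')(w-w'))]$. The non-zero values attained by $\rho_{\mathbb{D}^2}$ are exactly the dual numbers $[\delta_1,\delta_2]$ with $\delta_1>0$. The unit distance problem in $\mathbb{D}^2$ asks for the maximum number of pairs at distance $[1,0]$ in a set of $n$ points. The multiplicity of a finite nonempty set $\mathcal{P}\subset\mathbb{D}^2$ is the largest integer $k$ such that there exist $k$ points of $\mathcal{P}$ with the same real part. *)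

(* Defs.v *)
From HB Require Import structures.
From mathcomp Require Import all_boot all_order all_algebra finmap.
From mathcomp Require Import all_classical all_reals all_analysis.
From mathcomp Require Import ring.

Set Implicit Arguments.
Unset Strict Implicit.
Unset Printing Implicit Defensive.

Import Order.TTheory GRing.Theory Num.Theory.

Local Open Scope ring_scope.

(** [Dual x y] is the dual number x + y eps. A record rather than [R * R],
    whose canonical ring structure is the componentwise one. *)
Record dual_number (R : realType) := Dual { dre : R; deps : R }.
Arguments Dual {R} dre deps.

Section DualNumbers.
Variable R : realType.
Implicit Types (a b c : dual_number R) (x y : R).

Definition dual_pair a : R * R := (dre a, deps a).
Definition pair_dual (u : R * R) : dual_number R := Dual u.1 u.2.

Lemma dual_pairK : cancel dual_pair pair_dual.
Proof. by case. Qed.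

HB.instance Definition _ := Choice.copy (dual_number R) (can_type dual_pairK).

Definition dual_add a b := Dual (dre a + dre b) (deps a + deps b).
Definition dual_opp a := Dual (- dre a) (- deps a).
Definition dual_one : dual_number R := Dual 1 0.
Definition dual_mul a b :=
  Dual (dre a * dre b) (dre a * deps b + deps a * dre b).
Definition dual_scale x a := Dual (x * dre a) (x * deps a).

Lemma dual_addA : associative dual_add.
Proof. by move=> a b c; congr Dual; rewrite /= addrA. Qed.

Lemma dual_addC : commutative dual_add.
Proof. by move=> a b; congr Dual; rewrite /= addrC. Qed.

Lemma dual_add0 : left_id (Dual 0 0) dual_add.
Proof. by case=> x y; congr Dual; rewrite /= add0r. Qed.

Lemma dual_addN : left_inverse (Dual 0 0) dual_opp dual_add.
Proof. by move=> a; congr Dual; rewrite /= addNr. Qed.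

HB.instance Definition _ := GRing.isZmodule.Build (dual_number R)
  dual_addA dual_addC dual_add0 dual_addN.

Lemma dual_mulA : associative dual_mul.
Proof. by move=> a b c; congr Dual => /=; ring. Qed.

Lemma dual_mulC : commutative dual_mul.
Proof. by move=> a b; congr Dual => /=; ring. Qed.

Lemma dual_mul1 : left_id dual_one dual_mul.
Proof. by case=> x y; congr Dual => /=; ring. Qed.

Lemma dual_mulDl : left_distributive dual_mul +%R.
Proof. by move=> a b c; congr Dual => /=; ring. Qed.

Lemma dual_one_neq0 : dual_one != 0.
Proof. by apply/eqP => -[/eqP]; rewrite oner_eq0. Qed.

HB.instance Definition _ := GRing.Zmodule_isComNzRing.Build (dual_number R)
  dual_mulA dual_mulC dual_mul1 dual_mulDl dual_one_neq0.

Lemma dual_scaleA x y a : dual_scale x (dual_scale y a) = dual_scale (x * y) a.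
Proof. by congr Dual; rewrite /= mulrA. Qed.

Lemma dual_scale1 : left_id 1 dual_scale.
Proof. by case=> x y; congr Dual; rewrite /= mul1r. Qed.

Lemma dual_scaleDr : right_distributive dual_scale +%R.
Proof. by move=> x a b; congr Dual; rewrite /= mulrDr. Qed.

Lemma dual_scaleDl a : {morph dual_scale^~ a : x y / x + y}.
Proof. by move=> x y; congr Dual; rewrite /= mulrDl. Qed.

HB.instance Definition _ := GRing.Zmodule_isLmodule.Build R (dual_number R)
  dual_scaleA dual_scale1 dual_scaleDr dual_scaleDl.

Lemma dual_scaleAl x a b : x *: (a * b) = (x *: a) * b.
Proof. by congr Dual => /=; ring. Qed.

HB.instance Definition _ := GRing.Lmodule_isLalgebra.Build R (dual_number R)
  dual_scaleAl.
HB.instance Definition _ := GRing.Lalgebra_isComAlgebra.Build R (dual_number R).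

Definition eps : dual_number R := Dual 0 1.

Lemma eps_sqr : eps ^+ 2 = 0.
Proof. by rewrite expr2; congr Dual => /=; ring. Qed.

Lemma dualE x y : Dual x y = x%:A + y *: eps.
Proof. by congr Dual => /=; ring. Qed.

Definition dual_plane : Type := (dual_number R * dual_number R)%type.
HB.instance Definition _ := Choice.on dual_plane.

Definition real_part (p : dual_plane) : R * R := (dre p.1, dre p.2).

Definition rho (p q : dual_plane) : dual_number R :=
  (p.1 - q.1) ^+ 2 + (p.2 - q.2) ^+ 2.

Lemma rhoE x y z w x' y' z' w' :
  rho (Dual x y, Dual z w) (Dual x' y', Dual z' w') =
  Dual ((x - x') ^+ 2 + (z - z') ^+ 2)
       (2 * ((x - x') * (y - y') + (z - z') * (w - w'))).
Proof. by rewrite /rho !expr2; congr Dual => /=; ring. Qed.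

(** The unordered pairs {p, q} of points of [P] at distance [d]. As
    [rho p p = 0], they are genuine two-point sets whenever [d != 0]. *)
Definition dist_pairs (d : dual_number R) (P : {fset dual_plane}) :
    {fset {fset dual_plane}} :=
  [fset [fset pq.1; pq.2] | pq in P `*` P & rho pq.1 pq.2 == d]%fset.

Definition is_max_pairs (n : nat) (d : dual_number R) (m : nat) : Prop :=
  (exists P : {fset dual_plane}, #|` P| = n /\ #|` dist_pairs d P| = m) /\
  (forall P : {fset dual_plane}, #|` P| = n -> (#|` dist_pairs d P| <= m)%N).

Definition multiplicity (P : {fset dual_plane}) : nat :=
  \max_(S <- fpowerset P | constant [seq real_part p | p <- S]) #|` S|.

End DualNumbers.

(* Main.v *)
Require Import Defs.
From HB Require Import structures.
From mathcomp Require Import all_boot all_order all_algebra finmap.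
From mathcomp Require Import all_classical all_reals all_analysis.
From mathcomp Require Import zify ring lra fintype finset finmap.

(** Multiplication by a dual number sigma with sigma^2 = delta is a bijection of
    the dual plane that turns distance [1,0] into distance delta and maps fibers
    of the real part to fibers, so only delta = [1,0] matters.

    Between the fibers of the plane over two real points at distance 1, the unit
    distance graph is a disjoint union of complete bipartite graphs A x B. As
    |A||B| <= 1 + 2|A|(|A|-1) + 2|B|(|B|-1), the edges are bounded by the number
    of these bicliques plus pairs of distinct points in a common fiber, each of
    which lies in at most two bicliques: this gives 8 n k for multiplicity k. Over
    a real unit pair (a, b) there are at most min(w a, w b) bicliques, w being the
    size of the fiber. Writing this minimum as the number of t with t < w a and
    t < w b reduces their total to unit distances between n_t real points with
    sum n_t = n.

    The O(m^(4/3)) bound for real unit distances is obtained without the crossing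
    lemma. A unit pair is an incidence between a point and the upper unit
    semicircle about the other one, and two such semicircles cross at most once.
    Sweeping a vertical line, the vertical order of the semicircles changes at
    most once for each pair, so ranks vary by at most m^2 in total. Grouping ranks
    into blocks of length t, with an offset for which at most m^2/t changes of
    block occur, and cutting the sweep of each block whenever t semicircles have
    entered it, yields O(m^2/t^2) cells met by at most 2t semicircles each; in a
    cell the incidence graph has no 4-cycle. Take t ~ m^(2/3). *)

Set Implicit Arguments.
Unset Strict Implicit.
Unset Printing Implicit Defensive.

Import Order.TTheory GRing.Theory Num.Theory.

(** * Incidences of curves swept by a line *)

Lemma sum_sqr_le (I : finType) (A : {set I}) (d : I -> nat) :
  (\sum_(i in A) d i) ^ 2 <= #|A| * \sum_(i in A) d i ^ 2.
Proof.
rewrite -mulnn big_distrlr /= -(leq_pmul2l (ltn0Sn 1)).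
have -> : 2 * (#|A| * \sum_(i in A) d i ^ 2) =
          \sum_(i in A) \sum_(j in A) (d i ^ 2 + d j ^ 2).
  under [RHS]eq_bigr => i _ do rewrite big_split /= sum_nat_const.
  by rewrite big_split /= sum_nat_const -big_distrr /= mul2n addnn.
rewrite big_distrr; apply: leq_sum => i _; rewrite big_distrr.
by apply: leq_sum => j _; exact: nat_Cauchy.
Qed.

(** * Incidence graphs without 4-cycles *)

Section K22Free.
Variables (Q T : finType) (inc : Q -> T -> bool).
Hypothesis inc_inj : forall p p' c d,
  inc p c -> inc p' c -> inc p d -> inc p' d -> p = p' \/ c = d.

(** By Cauchy-Schwarz, [I^2] is at most [r^2] times the number of triples of a curve and two points
    on it. With distinct points the triple is determined by them, as there are no 4-cycles; with
    equal points it is an incidence. *)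
Lemma incidences_K22_free (r : nat) :
  #|[set c | [exists p, inc p c]]| <= r ^ 2 ->
  #|[set pc | inc pc.1 pc.2]| <=
    r ^ 2 + #|[set p | [exists c, inc p c]]| * r.
Proof.
set C := finset _; set I := finset _; set M := finset _ => leCr.
pose d c := #|[set p | inc p c]|.
have IE : #|I| = \sum_(c in C) d c.
  rewrite -sum1_card (eq_bigl (fun pc => true && inc pc.1 pc.2)); last first.
    by move=> pc; rewrite inE.
  rewrite -(pair_big_dep xpredT inc (fun _ _ => 1)) /=.
  rewrite (exchange_big_dep (mem C)) /=; last first.
    by move=> p c _ pc; rewrite inE; apply/existsP; exists p.
  by apply: eq_bigr => c _; rewrite /d -sum1_card; apply: eq_bigl => p; rewrite inE.
have sqrI : \sum_(c in C) d c ^ 2 <= #|M| ^ 2 + #|I|.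
  pose D := [set x : T * (Q * Q) | inc x.2.1 x.1 && inc x.2.2 x.1].
  have -> : \sum_(c in C) d c ^ 2 = #|D|.
    rewrite -sum1_card (eq_bigl (fun x =>
      (x.1 \in C) && (inc x.2.1 x.1 && inc x.2.2 x.1))); last first.
      move=> x; rewrite !inE; case: (boolP (inc x.2.1 x.1)) => [px|]; last by rewrite andbF.
      by rewrite /=; case: existsP => //; case; exists x.2.1.
    rewrite -(pair_big_dep (mem C) (fun c pp => inc pp.1 c && inc pp.2 c)
      (fun _ _ => 1)) /=.
    apply: eq_bigr => c _; rewrite /d -mulnn -cardsX sum1_card; apply: eq_card => pp.
    by rewrite !inE.
  rewrite -(cardsID [set x : T * (Q * Q) | x.2.1 == x.2.2] D) addnC leq_add //.
    rewrite -mulnn -cardsX -(card_in_imset (f := snd)).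
      apply/subset_leq_card/subsetP => _ /imsetP[x + ->]; rewrite !inE.
      by case/and3P=> _ a b; apply/andP; split; apply/existsP; exists x.1.
    move=> [c [p p']] [d' [q q']]; rewrite !inE /=.
    case/and3P=> npp' a b /and3P[_ a' b'] [e1 e2].
    rewrite -e1 -e2 in a' b' *.
    by case: (inc_inj a b a' b') npp' => [->|-> //]; rewrite eqxx.
  rewrite -(card_in_imset (f := fun x : T * (Q * Q) => (x.2.1, x.1))).
    apply/subset_leq_card/subsetP => _ /imsetP[x + ->]; rewrite !inE.
    by case/andP=> /andP[].
  move=> [c [p p']] [d' [q q']]; rewrite !inE /=.
  by case/andP=> _ /eqP <- /andP[_ /eqP <-] [-> ->].
have := sum_sqr_le C d; rewrite -IE => le1.
have le2 : #|I| ^ 2 <= r ^ 2 * (#|M| ^ 2 + #|I|).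
  by apply: leq_trans le1 _; apply: leq_mul.
(* If [I > r^2 + |M| r], then [I (I - r^2) > (|M| r)^2], against [le2]. *)
rewrite leqNgt; apply/negP => lt; move: le2 lt.
move: #|I| #|M| => x m; clear; nia.
Qed.

End K22Free.

(** Hermite's identity. Passing from [a] to [a + 1] drops the term [a/t] and adds [(a + t)/t], one
    more. *)
Lemma sum_divD (t a : nat) : 0 < t -> \sum_(q < t) (a + q) %/ t = a.
Proof.
case: t => // t _; elim: a => [|a IH].
  by rewrite big1 // => i _; rewrite add0n divn_small.
apply/(@addIn (a %/ t.+1)).
have -> : \sum_(q < t.+1) (a.+1 + q) %/ t.+1 + a %/ t.+1 =
          \sum_(q < t.+1) (a + q) %/ t.+1 + (a + t.+1) %/ t.+1.
  rewrite -(big_mkord xpredT (fun q => (a.+1 + q) %/ t.+1)).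
  rewrite -(big_mkord xpredT (fun q => (a + q) %/ t.+1)).
  rewrite big_nat_recr //= [in RHS]big_nat_recl //= addn0.
  under eq_bigr do rewrite addSnnS.
  by rewrite addSnnS; lia.
by rewrite IH divnDr // divnn; lia.
Qed.

(* The offsets [q] separating [a] from [b] in the division into blocks of
   length [t] number at most [|a - b|], since the quotients average to [a/t]. *)
Lemma sum_div_neq (t a b : nat) : 0 < t ->
  \sum_(q < t) ((a + q) %/ t != (b + q) %/ t) <= (a - b) + (b - a).
Proof.
move=> t0; wlog le_ab : a b / a <= b.
  move=> H; case: (leqP a b) => [/H //|/ltnW/H]; rewrite addnC; congr (_ <= _).
  by apply: eq_bigr => q _; rewrite eq_sym.
have := sum_divD b t0; have := sum_divD a t0.
have : \sum_(q < t) ((a + q) %/ t != (b + q) %/ t) + \sum_(q < t) (a + q) %/ t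
   <= \sum_(q < t) (b + q) %/ t; last by lia.
rewrite -big_split; apply: leq_sum => q _ /=.
by have := leq_div2r t (leq_add le_ab (leqnn q)); lia.
Qed.

Lemma card_set_sum (I : finType) (P : pred I) : #|[set x | P x]| = \sum_x P x.
Proof.
by rewrite -sum1_card big_mkcond; apply: eq_bigr => x _; rewrite inE; case: (P x).
Qed.

Lemma leq_card_bigcup (I : Type) (r : seq I) (P : pred I) (T : finType)
  (F : I -> {set T}) :
  #|\bigcup_(i <- r | P i) F i| <= \sum_(i <- r | P i) #|F i|.
Proof.
elim/big_rec2: _ => [|i m A _ le]; first by rewrite cards0.
by apply: leq_trans (leq_card_setU _ _) _; rewrite leq_add2l.
Qed.

Lemma sum_ord_interval (J lo hi : nat) :
  \sum_(j < J) (lo <= j < hi) <= hi - lo.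
Proof.
apply: (@leq_trans (minn J hi - lo)); last by lia.
elim: J => [|J IH]; first by rewrite big_ord0.
by rewrite big_ord_recr /=; move: (\sum_(j < J) _) IH => x; case: (boolP (lo <= J < hi)); lia.
Qed.

Lemma sum_ord_eq_le1 (J b : nat) : \sum_(j < J) (b == j) <= 1.
Proof.
apply: leq_trans (leq_trans _ (sum_ord_interval J b b.+1)) _; last by lia.
by apply: leq_sum => j _; lia.
Qed.

(** * Cutting the sweep into cells *)

Section Cells.

(** [rk i c] is the position of the curve [c] in the vertical order at time [i]; the sweep line
    meets the point [p] at time [tm p]. By [inc_block] the curves through a point have consecutive
    ranks, so they meet few strips. *)
Variables (Q T : finType) (N : nat) (rk : nat -> T -> nat).
Variables (tm : Q -> nat) (inc : Q -> T -> bool).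
Hypothesis rk_inj : forall i, i <= N -> injective (rk i).
Hypothesis rk_lt : forall i c, rk i c < #|T|.
Hypothesis tm_le : forall p, tm p <= N.
Hypothesis rk_var : \sum_(i < N) \sum_c
  ((rk i c - rk i.+1 c) + (rk i.+1 c - rk i c)) <= #|T| ^ 2.
Hypothesis inc_block : forall p, exists l, forall c, inc p c ->
  l <= rk (tm p) c < l + #|[set d | inc p d]|.
Hypothesis inc_inj : forall p p' c d,
  inc p c -> inc p' c -> inc p d -> inc p' d -> p = p' \/ c = d.

Section Offset.

Variables (t q : nat).
Hypotheses (t_gt0 : 0 < t) (q_lt : q < t).

(** Ranks are cut into strips of length [t], shifted by [q]. [cell j e] holds the incidences in
    strip [j] at times when the number of earlier entries into it lies in [[e t, (e+1) t)]. *)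
Let strip i c := (rk i c + q) %/ t.
Let entries j i := [set c | (strip i c != j) && (strip i.+1 c == j)].
Let entered j i := \sum_(0 <= i' < i) #|entries j i'|.
Let cell j e p c :=
  [&& inc p c, strip (tm p) c == j & entered j (tm p) %/ t == e].
Let J := #|T| %/ t + 2.

Lemma strip_lt i c : strip i c < J.
Proof.
rewrite ltn_divLR // /J; have := ltn_ceil #|T| t_gt0; have := rk_lt i c.
by rewrite addn2 !mulSn; lia.
Qed.

Lemma entered_split j i k : i <= k ->
  entered j k = entered j i + \sum_(i <= i' < k) #|entries j i'|.
Proof. by move=> le_ik; rewrite /entered -big_cat_nat. Qed.

Lemma card_strip_le i j : i <= N -> #|[set c | strip i c == j]| <= t.
Proof.
move=> leiN; rewrite -[leqRHS]card_ord.
rewrite -(card_in_imset (f := fun c => Ordinal (ltn_pmod (rk i c + q) t_gt0))).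
  exact: max_card.
move=> c d; rewrite !inE => /eqP cj /eqP dj [eq_mod].
apply/(rk_inj leiN)/(@addIn q).
by rewrite (divn_eq (rk i c + q) t) (divn_eq (rk i d + q) t) eq_mod
  -/(strip _ _) cj -/(strip _ _) dj.
Qed.

Lemma strip_entry i k j c : i <= k -> strip i c != j -> strip k c == j ->
  exists2 i', i <= i' < k & c \in entries j i'.
Proof.
elim: k => [|k IH]; first by rewrite leqn0 => /eqP->; case: eqP.
rewrite leq_eqVlt => /predU1P[->|]; first by case: eqP.
rewrite ltnS => leik nij kj; case: (boolP (strip k c == j)) => [kj'|nkj].
  by have [i' ? ?] := IH leik nij kj'; exists i' => //; lia.
by exists k; rewrite ?inE ?nkj //; lia.
Qed.

(** A curve of the cell is in the strip at the earliest time of the cell or enters it before the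
    latest one. There are at most [t] of either kind, as the counter of entries stays in an interval
    of length [t]. *)
Lemma card_cell_curves j e : #|[set c | [exists p, cell j e p c]]| <= 2 * t.
Proof.
case: (set_0Vmem [set c | [exists p, cell j e p c]]) => [->|]; first by rewrite cards0.
case=> c0; rewrite inE => /existsP[p0 cell0].
pose P p := [exists c, cell j e p c].
have Pp0 : P p0 by apply/existsP; exists c0.
case: (@arg_minnP _ p0 P tm Pp0) => p1 /existsP[c1 cell1] min1.
case: (@arg_maxnP _ p0 P tm Pp0) => p2 /existsP[c2 cell2] max2.
have le12 : tm p1 <= tm p2 by apply: min1; apply/existsP; exists c2.
rewrite mul2n -addnn.
apply: (@leq_trans #|[set c | strip (tm p1) c == j] :|:
  \bigcup_(tm p1 <= i' < tm p2) entries j i'|).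
  apply/subset_leq_card/subsetP => c; rewrite !inE => /existsP[p cellp].
  case: (boolP (strip (tm p1) c == j)) => //= n1.
  have Pp : P p by apply/existsP; exists c.
  case/and3P: cellp => _ sp _.
  have [i' /andP[le1 lt2] ce] := strip_entry (min1 _ Pp) n1 sp.
  rewrite (big_cat_nat _ (n := i')) //=; last first.
    by apply: leq_trans (ltnW lt2) _; exact: max2.
  rewrite inE (big_ltn (m := i')); last by apply: leq_trans lt2 _; exact: max2.
  by rewrite [X in _ || X]inE ce orbT.
apply: leq_trans (leq_card_setU _ _) _; apply: leq_add; first exact: card_strip_le.
apply: leq_trans (leq_card_bigcup _ _ _) _.
case/and3P: cell1 => _ _ /eqP e1; case/and3P: cell2 => _ _ /eqP e2.
have := entered_split j le12.
rewrite (divn_eq (entered j (tm p1)) t) (divn_eq (entered j (tm p2)) t) e1 e2.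
by have := ltn_pmod (entered j (tm p2)) t_gt0; lia.
Qed.

Lemma sum_entered_le : \sum_(j < J) entered j N <=
  \sum_(i < N) \sum_c (strip i c != strip i.+1 c).
Proof.
rewrite /entered; under eq_bigr do rewrite big_mkord.
rewrite exchange_big; apply: leq_sum => i _ /=.
under eq_bigr do rewrite card_set_sum.
rewrite exchange_big; apply: leq_sum => c _ /=.
case: (boolP (strip i c == strip i.+1 c)) => [/eqP->|_] /=.
  by rewrite big1 // => j _; rewrite andNb.
apply: leq_trans (sum_ord_eq_le1 J (strip i.+1 c)).
by apply: leq_sum => j _; case: (_ != _); case: (_ == _).
Qed.

(** A block of [g] consecutive ranks meets at most [g/t + 2] strips. *)
Lemma card_point_strips p :
  t * \sum_(j < J) [exists c, inc p c && (strip (tm p) c == j)] <=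
  #|[set c | inc p c]| + 2 * t.
Proof.
have [l blk] := inc_block p; set g := #|_| in blk *.
apply: (@leq_trans (t * (((l + g + q) %/ t).+1 - (l + q) %/ t))).
  rewrite leq_pmul2l //; apply: leq_trans _ (sum_ord_interval J _ _).
  apply: leq_sum => j _; case: existsP => // -[c /andP[/blk/andP[lc cg] /eqP<-]].
  rewrite ltnS !leq_div2r ?leq_add2r //; exact: ltnW.
have := leq_trunc_div (l + g + q) t; have := ltn_ceil (l + q) t_gt0.
by rewrite mulnBr !mulSn !(mulnC t) mulSn; lia.
Qed.

(** A cell has at most [2t <= (2s)^2] curves, so the bound for graphs without 4-cycles applies with
    [r = 2s]. With [E] changes of strip there are at most [E/t + J] cells. A point is counted once
    per strip that it meets, since its time fixes the cell in the strip. *)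
Lemma incidences_offset (s : nat) : t = s ^ 2 ->
  t * #|[set pc | inc pc.1 pc.2]| <=
  4 * (t * \sum_(i < N) \sum_c (strip i c != strip i.+1 c)) + 4 * t ^ 2 * J
  + 2 * s * (#|[set pc | inc pc.1 pc.2]| + 2 * t * #|Q|).
Proof.
move=> ts; set I := #|_|.
pose M j e := #|[set p | [exists c, cell j e p c]]|.
have I_le : I <= \sum_(j < J) \sum_(e < (entered j N %/ t).+1)
   (4 * t + M j e * (2 * s)).
  apply: (@leq_trans (\sum_(j < J) \sum_(e < (entered j N %/ t).+1)
     #|[set pc | cell j e pc.1 pc.2]|)); last first.
    apply: leq_sum => j _; apply: leq_sum => e _.
    have -> : 4 * t = (2 * s) ^ 2 by rewrite ts expnMn.
    apply: incidences_K22_free => [p p' c d|].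
      by move=> /and3P[a _ _] /and3P[a' _ _] /and3P[b _ _] /and3P[b' _ _]; exact: inc_inj a a' b b'.
    by apply: leq_trans (card_cell_curves _ _) _; rewrite ts; nia.
  rewrite /I card_set_sum.
  under [leqRHS]eq_bigr => j _ do (under eq_bigr => e _ do rewrite card_set_sum).
  under [leqRHS]eq_bigr do rewrite exchange_big.
  rewrite exchange_big; apply: leq_sum => -[p c] _ /=.
  case: (boolP (inc p c)) => // pc.
  rewrite (bigD1 (Ordinal (strip_lt (tm p) c))) //=.
  apply: leq_trans (leq_addr _ _).
  have lt_e : entered (strip (tm p) c) (tm p) %/ t < (entered (strip (tm p) c) N %/ t).+1.
    by rewrite ltnS leq_div2r // (entered_split _ (tm_le p)) leq_addr.
  rewrite (bigD1 (Ordinal lt_e)) //=; apply: leq_trans (leq_addr _ _).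
  by rewrite /cell pc !eqxx.
have M_le : t * \sum_(j < J) \sum_(e < (entered j N %/ t).+1) M j e <=
    I + 2 * t * #|Q|.
  apply: (@leq_trans (\sum_p t * \sum_(j < J)
      [exists c, inc p c && (strip (tm p) c == j)])).
    rewrite -big_distrr leq_pmul2l // exchange_big; apply: leq_sum => j _ /=.
    rewrite /M; under eq_bigr do rewrite card_set_sum.
    rewrite exchange_big; apply: leq_sum => p _ /=.
    case: (boolP [exists c, _]) => [_|/existsPn no].
      apply: leq_trans (sum_ord_eq_le1 _ (entered j (tm p) %/ t)).
      by apply: leq_sum => e _; case: existsP => // -[c /and3P[_ _ ->]].
    rewrite big1 // => e _; case: existsP => // -[c /and3P[a b _]].
    by have := no c; rewrite a b.
  apply: (@leq_trans (\sum_p (#|[set c | inc p c]| + 2 * t))).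
    by apply: leq_sum => p _; exact: card_point_strips.
  rewrite big_split /= sum_nat_const mulnC leq_add2r.
  rewrite /I card_set_sum; under eq_bigr do rewrite card_set_sum.
  by rewrite pair_big.
have num_le : t * \sum_(j < J) \sum_(e < (entered j N %/ t).+1) 4 * t <=
    4 * (t * \sum_(i < N) \sum_c (strip i c != strip i.+1 c)) + 4 * t ^ 2 * J.
  under eq_bigr do rewrite sum_nat_const card_ord.
  apply: (@leq_trans (t * \sum_(j < J) (4 * (entered j N + t)))).
    rewrite leq_pmul2l //; apply: leq_sum => j _.
    have := leq_trunc_div (entered j N) t; nia.
  rewrite -big_distrr big_split /= sum_nat_const card_ord.
  have := leq_mul (leqnn t) sum_entered_le.
  move: (\sum_(j < J) _) => X; move: (\sum_(i < N) _) => E le_XE.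
  move: (leq_mul (leqnn 4) le_XE); rewrite -mulnn !mulnDr; lia.
apply: leq_trans (leq_mul (leqnn t) I_le) _.
under eq_bigr do rewrite big_split /=.
rewrite big_split /= mulnDr; apply: leq_add => //.
under eq_bigr do rewrite -big_distrl /=.
by rewrite -big_distrl mulnA [leqLHS]mulnC; apply: leq_mul.
Qed.

End Offset.

Theorem incidences_le (s : nat) :
  #|Q| = #|T| -> 4 <= s -> #|T| <= s ^ 3 ->
  #|[set pc | inc pc.1 pc.2]| <= 40 * s * #|T|.
Proof.
move=> QT s4 Ts; set I := #|_|.
(* Below [s] curves the trivial bound suffices; otherwise [s^2 <= s |T|] absorbs the two extra
   strips in [J]. *)
have [lt_sT|le_Ts] := ltnP #|T| s.
  apply: (@leq_trans (#|Q| * #|T|)); last by rewrite QT; nia.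
  by rewrite -card_prod max_card.
have t_gt0 : 0 < s ^ 2 by rewrite expn_gt0; lia.
(* Summed over all [s^2] offsets, the changes of strip number at most the total variation of the
   ranks; the best offset does no worse than the average. *)
have [q q_lt q_le] : exists2 q, q < s ^ 2 & s ^ 2 * \sum_(i < N) \sum_c
    ((rk i c + q) %/ s ^ 2 != (rk i.+1 c + q) %/ s ^ 2) <= #|T| ^ 2.
  pose E q := \sum_(i < N) \sum_c
    ((rk i c + q) %/ s ^ 2 != (rk i.+1 c + q) %/ s ^ 2).
  have sumE : \sum_(q < s ^ 2) E q <= #|T| ^ 2.
    apply: leq_trans rk_var; rewrite exchange_big; apply: leq_sum => i _ /=.
    rewrite exchange_big; apply: leq_sum => c _ /=; exact: sum_div_neq.
  case: (@arg_minnP _ (Ordinal t_gt0) xpredT (fun q : 'I_(s ^ 2) => E q) isT).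
  move=> q _ minq; exists q => //; apply: leq_trans sumE.
  rewrite -[X in X * _ <= _]card_ord -sum_nat_const.
  by apply: leq_sum => k _; exact: minq.
have := incidences_offset t_gt0 q_lt erefl; rewrite -/I QT.
have : s ^ 2 * (#|T| %/ s ^ 2) <= #|T| by rewrite mulnC leq_trunc_div.
move: q_le; set E := \sum_(i < N) _; move: E (#|T| %/ s ^ 2) I => E D I.
move: #|T| Ts le_Ts => n; clear -s4; move=> ns sn qle dle.
rewrite (mulnDr _ D 2); move=> h.
have n2 : n ^ 2 <= s ^ 3 * n by nia.
have d2 : 4 * (s ^ 2) ^ 2 * D <= 4 * s ^ 2 * n by nia.
(* The term [2 s I] takes at most half of [s^2 I], as [s >= 4]. *)
have i2 : s * s * I >= 4 * s * I by nia.
have h2 : s ^ 2 * I <= 2 * (s ^ 2 * (4 * s * n + 4 * n + 8 * s ^ 2 + 4 * s * n)).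
  nia.
rewrite mulnCA leq_pmul2l // in h2; nia.
Qed.

End Cells.

(** * Unit distances in the real plane *)

Section AllowableSequence.

Variables (d : Order.disp_t) (O : orderType d) (T : finType).
Variables (N : nat) (key : nat -> T -> O).
Hypothesis key_inj : forall i, injective (key i).
Hypothesis key_mono : forall c c',
  (forall i, (i < N)%N -> (key i c < key i c')%O -> (key i.+1 c < key i.+1 c')%O) \/
  (forall i, (i < N)%N -> (key i.+1 c < key i.+1 c')%O -> (key i c < key i c')%O).

Definition order_rank i c := #|[set c' | (key i c' < key i c)%O]|.

Lemma order_rank_lt i c : (order_rank i c < #|T|)%N.
Proof.
rewrite -cardsT; apply/proper_card/properP; split; first exact: subsetT.
by exists c; rewrite ?inE ?ltxx.
Qed.

Lemma order_rank_inj i : injective (order_rank i).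
Proof.
suff mono c c' : (key i c < key i c')%O -> (order_rank i c < order_rank i c')%N.
  move=> c c' eq_rk; apply: (@key_inj i).
  by case: (ltgtP (key i c) (key i c')) => // /mono; rewrite eq_rk ltnn.
move=> lt_cc'; apply/proper_card/properP; split; last by exists c; rewrite !inE ?ltxx.
by apply/subsetP => c1; rewrite !inE => /lt_trans; apply.
Qed.

Lemma sum_bool_changes (b : nat -> bool) :
  (forall i, (i < N)%N -> b i -> b i.+1) \/ (forall i, (i < N)%N -> b i.+1 -> b i) ->
  (\sum_(i < N) (b i != b i.+1) <= 1)%N.
Proof.
case=> mono.
  suff: (\sum_(i < N) (b i != b i.+1) + b 0 <= b N)%N.
    by move: (\sum_(i < N) _)%N => S; case: (b 0) (b N) => [] []; lia.
  elim: N mono => [|n IH] mono; first by rewrite big_ord0.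
  rewrite big_ord_recr /=; have := mono n (ltnSn n).
  have := IH (fun i lt => mono i (ltnW lt)).
  move: (\sum_(i < n) _)%N => S; case: (b 0) (b n) (b n.+1) => [] [] []; lia.
suff: (\sum_(i < N) (b i != b i.+1) + b N <= b 0)%N.
  by move: (\sum_(i < N) _)%N => S; case: (b 0) (b N) => [] []; lia.
elim: N mono => [|n IH] mono; first by rewrite big_ord0.
rewrite big_ord_recr /=; have := mono n (ltnSn n).
have := IH (fun i lt => mono i (ltnW lt)).
move: (\sum_(i < n) _)%N => S; case: (b 0) (b n) (b n.+1) => [] [] []; lia.
Qed.

(** The rank of [c] moves by at most the number of elements whose order relative to [c] changes, and
    each ordered pair accounts for at most one change in all. *)
Lemma order_rank_variation : (\sum_(i < N) \sum_c
  ((order_rank i c - order_rank i.+1 c) + (order_rank i.+1 c - order_rank i c))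
  <= #|T| ^ 2)%N.
Proof.
apply: (@leq_trans (\sum_(i < N) \sum_c \sum_c'
    ((key i c' < key i c)%O != (key i.+1 c' < key i.+1 c)%O))%N).
  apply: leq_sum => i _; apply: leq_sum => c _.
  rewrite /order_rank !card_set_sum.
  have le (x y : T -> bool) :
      (\sum_c' x c' <= \sum_c' y c' + \sum_c' (x c' != y c'))%N.
    by rewrite -big_split; apply: leq_sum => c' _; case: (x c') (y c') => [] [].
  have := le (fun c' => key i c' < key i c)%O (fun c' => key i.+1 c' < key i.+1 c)%O.
  have := le (fun c' => key i.+1 c' < key i.+1 c)%O (fun c' => key i c' < key i c)%O.
  under [X in (_ <= _ + X)%N -> _]eq_bigr do rewrite eq_sym.
  set X := (\sum_c' _)%N; set Y := (\sum_c' _)%N; set Z := (\sum_c' _)%N.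
  move: X Y Z => X Y Z; lia.
rewrite exchange_big -mulnn -sum_nat_const; apply: leq_sum => c _ /=.
rewrite exchange_big -sum1_card; apply: leq_sum => c' _ /=.
exact: (sum_bool_changes (b := fun i => (key i c' < key i c)%O)).
Qed.

End AllowableSequence.

(** * Unit semicircles and their crossings *)

Section UnitDistances.

Variable R : rcfType.
Implicit Types (x y h a b : R).
Local Open Scope ring_scope.

Definition semicircle x := Num.sqrt (1 - x ^+ 2).

Lemma sqr_semicircle x : -1 <= x <= 1 -> semicircle x ^+ 2 = 1 - x ^+ 2.
Proof. by case/andP=> le1 le2; rewrite sqr_sqrtr //; nra. Qed.

Lemma semicircle_ge0 x : 0 <= semicircle x. Proof. exact: sqrtr_ge0. Qed.

(** Distinct unit vectors have inner product below 1, so their proper convex combinations lie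
    strictly inside the circle. *)
Lemma semicircle_strictly_concave a b l m : -1 <= a -> a < b -> b <= 1 ->
  0 < l -> 0 < m -> l + m = 1 ->
  l * semicircle a + m * semicircle b < semicircle (l * a + m * b).
Proof.
move=> a1 ab b1 l0 m0 lm.
have u2 : semicircle a ^+ 2 = 1 - a ^+ 2 by apply: sqr_semicircle; lra.
have v2 : semicircle b ^+ 2 = 1 - b ^+ 2 by apply: sqr_semicircle; lra.
move: (semicircle_ge0 a) (semicircle_ge0 b) u2 v2.
rewrite {7}/semicircle; move: (semicircle a) (semicircle b) => u v u0 v0 u2 v2.
have -> : l * u + m * v = Num.sqrt ((l * u + m * v) ^+ 2).
  by rewrite sqrtr_sqr ger0_norm //; nra.
have ab0 : 0 < (b - a) ^+ 2 by rewrite exprn_gt0 // subr_gt0.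
have lt1 : a * b + u * v < 1.
  have := sqr_ge0 (u - v); rewrite sqrrB u2 v2; rewrite sqrrB in ab0; lra.
have lt2 : (l * u + m * v) ^+ 2 < 1 - (l * a + m * b) ^+ 2.
  rewrite -subr_gt0.
  have -> : 1 - (l * a + m * b) ^+ 2 - (l * u + m * v) ^+ 2 =
      2 * (l * m * (1 - (a * b + u * v))).
    have -> : (l * a + m * b) ^+ 2 =
        l ^+ 2 * a ^+ 2 + m ^+ 2 * b ^+ 2 + 2 * l * m * (a * b) by ring.
    have -> : (l * u + m * v) ^+ 2 =
        l ^+ 2 * u ^+ 2 + m ^+ 2 * v ^+ 2 + 2 * l * m * (u * v) by ring.
    by rewrite u2 v2 (_ : m = 1 - l); [ring | lra].
  by rewrite !mulr_gt0 // subr_gt0.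
by rewrite ltr_sqrt //; apply: le_lt_trans lt2; exact: sqr_ge0.
Qed.

(** [b] and [a + h] are convex combinations of [a] and [b + h] with the same weights exchanged; the
    two concavity inequalities are added. *)
Lemma semicircle_increments a b h : -1 <= a -> a < b -> 0 < h -> b + h <= 1 ->
  semicircle (b + h) + semicircle a < semicircle b + semicircle (a + h).
Proof.
move=> a1 ab h0 bh.
pose l := h / (b + h - a); pose m := (b - a) / (b + h - a).
have L0 : 0 < b + h - a by lra.
have l0 : 0 < l by rewrite divr_gt0.
have m0 : 0 < m by rewrite divr_gt0 // subr_gt0.
have lm : l + m = 1 by rewrite /l /m; field; rewrite gt_eqF.
have abh : a < b + h by lra.
have := semicircle_strictly_concave a1 abh bh l0 m0 lm.
have := semicircle_strictly_concave a1 abh bh m0 l0 (etrans (addrC m l) lm).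
have -> : l * a + m * (b + h) = b by rewrite /l /m; field; rewrite gt_eqF.
have -> : m * a + l * (b + h) = a + h by rewrite /l /m; field; rewrite gt_eqF.
rewrite (_ : m = 1 - l); [lra | by rewrite -lm; ring].
Qed.

Definition overshoot x := Num.min 0 (1 - x ^+ 2).

Lemma overshoot0 x : -1 <= x <= 1 -> overshoot x = 0.
Proof. by case/andP=> *; apply/min_idPl; nra. Qed.

(* Outside its span a semicircle is prolonged below all points of the plane, the
   farther the lower: the first component makes the order lexicographic. *)
Definition arc_key x (c : R * R) : R *l R :=
  (overshoot (x - c.1), c.2 + semicircle (x - c.1)).

(** The arc with the left center passes from above to below. Within both spans it has the smaller
    height increment, by concavity; past its right end it is farther outside its span than the other
    arc. *)
Lemma arc_key_crossing x x' (c c' : R * R) : c.1 < c'.1 -> x < x' ->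
  (arc_key x c <= arc_key x c')%O -> (arc_key x' c < arc_key x' c')%O.
Proof.
case: c c' => [c1 c2] [d1 d2] /= cd xx'; rewrite /arc_key /= lexi_pair ltxi_pair.
have -> : x' - c1 = (x - c1) + (x' - x) by ring.
have -> : x' - d1 = (x - d1) + (x' - x) by ring.
have : 0 < x' - x by lra.
have : x - d1 < x - c1 by lra.
move: (x - c1) (x - d1) (x' - x) => w v h vw h0 {cd xx'} /andP[le1 /implyP le2].
(* If [v < -1], the order of the overshoots forces [v^2 <= w^2], and [v < w] leaves only
   [- v <= w]. *)
have v1 : v < -1 -> - v <= w.
  move=> v1; have : overshoot v = 1 - v ^+ 2 by apply/min_idPr; nra.
  move: le1; rewrite {1}/overshoot ge_min => /[swap] ->.
  by case/orP => *; nra.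
have [wh|wh] := leP (w + h) 1.
  have v1' : -1 <= v by rewrite leNgt; apply/negP => /[dup] /v1; lra.
  rewrite !overshoot0 ?lexx /= in le2 *; try by apply/andP; split; lra.
  by have := semicircle_increments v1' vw h0 wh; have := le2 isT; lra.
(* Beyond the span of the left arc, [w + h] exceeds [|v + h|], so the overshoots decide. *)
have pos : 0 < w + v + 2 * h.
  by have [v1'|/v1] := leP (-1) v; lra.
have lt : overshoot (w + h) < overshoot (v + h).
  rewrite /overshoot lt_min !gt_min; apply/andP; split; apply/orP; right; nra.
by rewrite (ltW lt) leNgt lt.
Qed.

Lemma arc_key_incident x y (c : R * R) :
  reflect ((x - c.1) ^+ 2 + (y - c.2) ^+ 2 = 1 /\ c.2 <= y)
    (arc_key x c == (0, y)).
Proof.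
rewrite /arc_key xpair_eqE; apply: (iffP andP).
  case=> /eqP/min_idPl le1 /eqP <-.
  rewrite addrAC subrr add0r sqr_sqrtr // lerDl sqrtr_ge0; split=> //; ring.
case=> eq1 le2; rewrite /overshoot /semicircle.
have -> : 1 - (x - c.1) ^+ 2 = (y - c.2) ^+ 2 by rewrite -eq1; ring.
rewrite min_l ?sqr_ge0 // sqrtr_sqr ger0_norm ?subr_ge0 //.
by rewrite eqxx; split=> //; apply/eqP; ring.
Qed.

Definition unit_apart (u v : R * R) :=
  (u.1 - v.1) ^+ 2 + (u.2 - v.2) ^+ 2 == 1.

Section Bound.

Variables (T : finType) (z : T -> R * R).
Hypothesis z_inj : injective z.

Let inc (p c : T) := arc_key (z p).1 (z c) == (0, (z p).2).

(** Equal keys at two abscissae contradict the single crossing unless the centers share their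
    abscissa, and then equal keys give equal centers. Points of equal abscissa on one semicircle
    coincide. *)
Lemma incident_K22_free p p' c d :
  inc p c -> inc p' c -> inc p d -> inc p' d -> p = p' \/ c = d.
Proof.
move=> /eqP pc /eqP p'c /eqP pd /eqP p'd.
have cross c1 d1 q q' : (z c1).1 < (z d1).1 -> (z q).1 < (z q').1 ->
    arc_key (z q).1 (z c1) = arc_key (z q).1 (z d1) ->
    arc_key (z q').1 (z c1) = arc_key (z q').1 (z d1) -> False.
  move=> lt1 lt2 e e'; have := arc_key_crossing lt1 lt2.
  by rewrite e e' lexx ltxx => /(_ isT).
case: (ltgtP (z p).1 (z p').1) => [lt_p|lt_p|eq_p].
- case: (ltgtP (z c).1 (z d).1) => [lt_c|lt_c|eq_c].
  + by case: (cross _ _ _ _ lt_c lt_p); congruence.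
  + by case: (cross _ _ _ _ lt_c lt_p); congruence.
  + right; apply: z_inj; move: pc; rewrite -pd /arc_key eq_c => -[/addIr].
    by case: (z c) (z d) eq_c => ? ? [? ?] /= -> ->.
- case: (ltgtP (z c).1 (z d).1) => [lt_c|lt_c|eq_c].
  + by case: (cross _ _ _ _ lt_c lt_p); congruence.
  + by case: (cross _ _ _ _ lt_c lt_p); congruence.
  + right; apply: z_inj; move: pc; rewrite -pd /arc_key eq_c => -[/addIr].
    by case: (z c) (z d) eq_c => ? ? [? ?] /= -> ->.
- left; apply: z_inj; move: pc p'c; rewrite eq_p => -> [].
  by case: (z p) (z p') eq_p => ? ? [? ?] /= -> ->.
Qed.

(** Time runs through the sorted abscissae of the points, with repetitions. The second component of
    [key] breaks ties of [arc_key]; together they determine the center. *)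
Let xs := sort <=%R [seq (z p).1 | p <- enum T].
Let tm p := index (z p).1 xs.
Let key i c : (R *l R) *l R := (arc_key (nth 0 xs i) (z c), - (z c).1).

Lemma sweep_key_inj i : injective (key i).
Proof.
move=> c d [_ eq2 /oppr_inj eq1]; apply: z_inj.
by move: eq2; rewrite eq1 => /addIr; case: (z c) (z d) eq1 => ? ? [? ?] /= -> ->.
Qed.

Lemma size_abscissae : size xs = #|T|.
Proof. by rewrite size_sort size_map -cardE. Qed.

Lemma sweep_time_lt p : (tm p < #|T|)%N.
Proof.
by rewrite -size_abscissae index_mem mem_sort; apply: map_f; rewrite mem_enum.
Qed.

Lemma nth_sweep_time p : nth 0 xs (tm p) = (z p).1.
Proof. by rewrite nth_index // -index_mem size_abscissae sweep_time_lt. Qed.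

(** For centers of distinct abscissae this is the single crossing; for equal ones the order is
    always that of the ordinates. *)
Lemma sweep_key_monotone c d :
  (forall i, (i < #|T|.-1)%N -> (key i c < key i d)%O -> (key i.+1 c < key i.+1 d)%O) \/
  (forall i, (i < #|T|.-1)%N -> (key i.+1 c < key i.+1 d)%O -> (key i c < key i d)%O).
Proof.
have up c1 d1 : (z c1).1 < (z d1).1 -> forall i, (i < #|T|.-1)%N ->
    (key i c1 < key i d1)%O -> (key i.+1 c1 < key i.+1 d1)%O.
  move=> lt_c i iT; have : nth 0 xs i <= nth 0 xs i.+1.
    apply: (sorted_leq_nth le_trans lexx 0 (sort_sorted (@le_total _ R) _));
      by rewrite ?inE ?size_abscissae; lia.
  rewrite /key le_eqVlt => /predU1P[-> //|lt_x].
  rewrite !ltxi_pair => /andP[/(arc_key_crossing lt_c lt_x) lt _].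
  by rewrite (ltW lt) leNgt lt.
case: (ltgtP (z c).1 (z d).1) => [/up|lt_c|eq_c]; [by left | right | right].
  move=> i iT; apply: contraTT; rewrite -!leNgt.
  rewrite le_eqVlt => /predU1P[/sweep_key_inj -> //|/(up _ _ lt_c i iT)].
  exact: ltW.
have keyE i : (key i c < key i d)%O = ((z c).2 < (z d).2).
  rewrite /key ltxi_pair /arc_key !lexi_pair eq_c !lexx ltxx implybF /= !lerD2r -ltNge.
  by rewrite andb_idl // => /ltW.
by move=> i _; rewrite !keyE.
Qed.

(** The curves through [p] share the [arc_key] [P] at its abscissa, so they are consecutive,
    preceded only by the curves of smaller [arc_key]. *)
Lemma incident_block p : exists l, forall c, inc p c ->
  (l <= order_rank key (tm p) c < l + #|[set d | inc p d]|)%N.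
Proof.
pose P : R *l R := (0, (z p).2).
exists #|[set d | (arc_key (z p).1 (z d) < P)%O]| => c pc.
have keyP d : (key (tm p) d < key (tm p) c)%O =
    (arc_key (z p).1 (z d) <= P)%O &&
    ((P <= arc_key (z p).1 (z d))%O ==> (- (z d).1 < - (z c).1)%O).
  by rewrite /key nth_sweep_time ltxi_pair (eqP pc).
apply/andP; split.
  apply/subset_leq_card/subsetP => d; rewrite !inE keyP => lt.
  by rewrite (ltW lt) leNgt lt.
rewrite -cardsUI [X in (_ < _ + X)%N](_ : _ = 0%N) ?addn0; last first.
  by apply/eq_card0 => d; rewrite !inE /inc; case: eqP => [->|]; rewrite ?ltxx ?andbF.
apply/proper_card/properP; split; last first.
  by exists c; rewrite !inE ?pc ?orbT ?ltxx.
apply/subsetP => d; rewrite !inE keyP => /andP[le _].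
by move: le; rewrite le_eqVlt orbC.
Qed.

(** In a unit pair the higher point lies on the upper semicircle about the lower one. Ordered pairs
    are counted, hence [80 = 2 * 40]. *)
Theorem unit_distances_le (s : nat) : (4 <= s)%N -> (#|T| <= s ^ 3)%N ->
  (#|[set pq | unit_apart (z pq.1) (z pq.2)]| <= 80 * s * #|T|)%N.
Proof.
move=> s4 Ts; pose I := [set pq | inc pq.1 pq.2].
have I_le : (#|I| <= 40 * s * #|T|)%N.
  apply: (incidences_le (N := #|T|.-1) (rk := order_rank key) (tm := tm)) => //.
  - move=> i _. exact: (order_rank_inj sweep_key_inj).
  - exact: order_rank_lt.
  - by move=> p; have := sweep_time_lt p; lia.
  - exact: order_rank_variation sweep_key_monotone.
  - exact: incident_block.
  - exact: incident_K22_free.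
apply: (@leq_trans #|I :|: [set (pq.2, pq.1) | pq in I]|).
  apply/subset_leq_card/subsetP => -[p q]; rewrite !inE /= => /eqP pq.
  case: (lerP (z q).2 (z p).2) => [le_qp|/ltW le_pq].
    by apply/orP; left; apply/arc_key_incident.
  apply/orP; right; apply/imsetP; exists (q, p) => //; rewrite inE /=.
  by apply/arc_key_incident; split=> //; rewrite -pq; ring.
apply: leq_trans (leq_card_setU _ _) _.
have := leq_imset_card (fun pq => (pq.2, pq.1)) I; lia.
Qed.

End Bound.

End UnitDistances.

(** * Weighted unit distances *)

Section WeightedUnitDistances.

Variables (R : rcfType) (T : finType) (z : T -> R * R).

Lemma unit_distances_in_le (A : {set T}) (s : nat) :
  {in A &, injective z} -> (4 <= s)%N -> (#|A| <= s ^ 3)%N ->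
  (#|[set pq | [&& pq.1 \in A, pq.2 \in A & unit_apart (z pq.1) (z pq.2)]]|
   <= 80 * s * #|A|)%N.
Proof.
move=> z_inj s4 As; pose S := {x | x \in A}.
have S_inj : injective (fun x : S => z (val x)).
  by move=> [x xA] [y yA] /= /(z_inj _ _ xA yA) eq_xy; apply: val_inj.
have := unit_distances_le S_inj s4; rewrite card_sig => /(_ As); apply: leq_trans.
rewrite -(card_imset (f := fun pq : S * S => (val pq.1, val pq.2))); last first.
  by move=> [p q] [p' q'] [/val_inj -> /val_inj ->].
apply/subset_leq_card/subsetP => -[p q]; rewrite !inE /= => /and3P[pA qA pq].
by apply/imsetP; exists (exist _ p pA, exist _ q qA); rewrite ?inE.
Qed.

Lemma sum_ord_lt (M k : nat) : (\sum_(t < M) (t < k) = minn M k)%N.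
Proof.
elim: M => [|M IH]; first by rewrite big_ord0 min0n.
by rewrite big_ord_recr /= IH; case: (ltnP M k); lia.
Qed.

(** [minn (w a) (w b)] counts the levels [L t] that contain both [a] and [b]. The unweighted bound
    applies to each level, and the sizes of the levels add up to the total weight. *)
Lemma unit_distances_weighted_le (A : {set T}) (w : T -> nat) (s : nat) :
  {in A &, injective z} -> (4 <= s)%N -> (\sum_(a in A) w a <= s ^ 3)%N ->
  (\sum_(ab | [&& ab.1 \in A, ab.2 \in A & unit_apart (z ab.1) (z ab.2)])
     minn (w ab.1) (w ab.2) <= 80 * s * \sum_(a in A) w a)%N.
Proof.
move=> z_inj s4; set W := (\sum_(a in A) w a)%N => Ws.
have w_le a : a \in A -> (w a <= W)%N.
  by move=> aA; rewrite /W (bigD1 a) //= leq_addr.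
pose L t := [set a in A | (t < w a)%N].
have sumL : (\sum_(t < W) #|L t| = W)%N.
  under eq_bigr do rewrite -sum1_card big_mkcond.
  rewrite exchange_big [RHS]big_mkcond; apply: eq_bigr => a _ /=.
  case: ifP => aA; last by rewrite big1 // => t _; rewrite inE aA.
  rewrite -[RHS](minn_idPr (w_le a aA)) -sum_ord_lt.
  by apply: eq_bigr => t _; rewrite inE aA; case: ltnP.
have L_le (t : 'I_W) : (#|[set pq | [&& pq.1 \in L t, pq.2 \in L t
    & unit_apart (z pq.1) (z pq.2)]]| <= 80 * s * #|L t|)%N.
  apply: unit_distances_in_le => //.
    by move=> a b; rewrite !inE => /andP[aA _] /andP[bA _]; exact: z_inj.
  apply: leq_trans Ws; rewrite -sum1_card big_mkcond /W [leqRHS]big_mkcond.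
  by apply: leq_sum => a _; rewrite inE; case: (a \in A) => //=; case: ifP => //; lia.
rewrite -[in leqRHS]sumL big_distrr; apply: leq_trans (leq_sum _ (fun t _ => L_le t)).
under [leqRHS]eq_bigr do rewrite card_set_sum.
rewrite exchange_big big_mkcond; apply: leq_sum => -[a b] _ /=.
case: ifP => // /and3P[aA bA ab].
rewrite -(minn_idPr (leq_trans (geq_minl (w a) (w b)) (w_le a aA))) -sum_ord_lt.
by apply: leq_sum => t _; rewrite !inE aA bA ab leq_min /= andbT.
Qed.

End WeightedUnitDistances.

(** * Unit distances in the dual plane *)

Section Bicliques.

(** [rep] picks a representative of the fiber and [G] stands for unit distance of real parts.
    [E_fill] makes [E] between two fibers a disjoint union of bicliques; by [E_two], the common
    neighbors of two points of a fiber lie in at most two fibers. *)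
Variables (T : finType) (E : rel T) (rep : T -> T) (G : rel T) (k B : nat).
Hypothesis E_sym : symmetric E.
Hypothesis E_fill : forall p p' q q', rep p = rep p' -> rep q = rep q' ->
  E p q -> E p q' -> E p' q -> E p' q'.
Hypothesis E_two : forall p p', p != p' -> rep p = rep p' ->
  exists b1 b2, forall q, E p q -> E p' q -> rep q = b1 \/ rep q = b2.
Hypothesis fiber_le : forall a, #|[set p | rep p == a]| <= k.
Hypothesis E_G : forall p q, E p q -> G (rep p) (rep q).
Hypothesis G_le : \sum_(ab | G ab.1 ab.2)
  minn #|[set p | rep p == ab.1]| #|[set p | rep p == ab.2]| <= B.

Let nbrs p q := [set p' | (rep p' == rep p) && E p' q].
Let biclique pq := (nbrs pq.1 pq.2, nbrs pq.2 pq.1).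
Let edges := [set pq | E pq.1 pq.2].
Let bicliques := biclique @: edges.

Lemma nbrs_eq p q p0 q0 : rep p = rep p0 -> rep q = rep q0 ->
  E p0 q0 -> E p q0 -> E p q -> nbrs p q = nbrs p0 q0.
Proof.
move=> rp rq e00 ep0 epq; apply/setP => x; rewrite !inE -rp.
case: eqP => //= rx; apply/idP/idP => [exq|ex0].
  exact: E_fill (esym rx) rq epq ep0 exq.
exact: E_fill (esym rx) (esym rq) ep0 epq ex0.
Qed.

(** The edge [(p, q0)] shares an endpoint with each of the other two, so all three lie in one
    biclique. *)
Lemma biclique_eq p q p0 q0 : rep p = rep p0 -> rep q = rep q0 ->
  E p0 q0 -> E p q0 -> E p q -> biclique (p, q) = biclique (p0, q0).
Proof.
move=> rp rq e00 ep0 epq; congr pair => /=; first exact: nbrs_eq.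
apply: nbrs_eq => //; rewrite E_sym //.
exact: E_fill rp (esym rq) ep0 epq e00.
Qed.

Let swap (K : {set T} * {set T}) := (K.2, K.1).

Lemma swap_bicliques K : (swap K \in bicliques) = (K \in bicliques).
Proof.
have sw K' : K' \in bicliques -> swap K' \in bicliques.
  case/imsetP=> -[p q]; rewrite inE /= => epq ->.
  by apply/imsetP; exists (q, p); rewrite // inE /= E_sym.
by apply/idP/idP => /sw //; case: K.
Qed.

Definition offdiag (A : {set T}) :=
  [set pp | [&& pp.1 != pp.2, pp.1 \in A & pp.2 \in A]].

Lemma card_offdiag (A : {set T}) : #|A| ^ 2 = #|offdiag A| + #|A|.
Proof.
rewrite -mulnn -cardsX -(cardsID [set pp | pp.1 != pp.2]); congr (_ + _).
  by apply: eq_card => pp; rewrite !inE andbC.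
rewrite -(card_imset (f := fun p => (p, p)) A); last by move=> p q [].
apply: eq_card => -[p q]; rewrite !inE negbK /=.
apply/andP/imsetP => [[/eqP <- /andP[pA _]]|[x xA [-> ->]]]; first by exists p.
by rewrite xA eqxx.
Qed.

(** Two distinct points on one side of a biclique share a fiber, so the other side lies over [b1] or
    [b2]. One of the points and that fiber determine the biclique. *)
Lemma sum_offdiag_le : \sum_(K in bicliques) #|offdiag K.1| <= 2 * (#|T| * k).
Proof.
under eq_bigr do rewrite card_set_sum.
rewrite exchange_big /=.
apply: (@leq_trans (\sum_(pp : T * T) 2 * (rep pp.2 == rep pp.1))); last first.
  rewrite -big_distrr leq_pmul2l //= -(pair_big xpredT xpredT
    (fun p p' => rep p' == rep p : nat)) /= -sum_nat_const.
  apply: leq_sum => p _; rewrite -(card_set_sum (fun p' => rep p' == rep p)).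
  exact: fiber_le.
apply: leq_sum => -[p p'] _ /=.
case: (eqVneq p p') => [|npp'] /=; first by rewrite big1.
case: (eqVneq (rep p') (rep p)) => [rp|nrp]; last first.
  rewrite big1 // => K /imsetP[[p0 q0] _ ->] /=; rewrite !inE.
  by case: (eqVneq (rep p) (rep p0)) => //= <-; rewrite (negbTE nrp) !andbF.
have [b1 [b2 b12]] := E_two npp' (esym rp).
(* [g b] is the biclique of [p] toward the fiber [b], with empty sets as default when [p] has no
   neighbor there. *)
pose g b := if [pick q | E p q && (rep q == b)] is Some q then biclique (p, q)
            else (set0, set0).
apply: (@leq_trans #|[set g b1; g b2]|); last by rewrite cards2; case: eqP.
rewrite -big_mkcondr /= sum1_card; apply/subset_leq_card/subsetP => K.
rewrite inE => /and3P[/imsetP[[p0 q0]]]; rewrite inE /= => e00 -> /=.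
rewrite !inE => /andP[/eqP rp0 ep0] /andP[_ ep'0].
suff -> : biclique (p0, q0) = g (rep q0).
  by case: (b12 q0 ep0 ep'0) => ->; rewrite eqxx ?orbT.
rewrite /g; case: pickP => [q /andP[epq /eqP rq]|/(_ q0)]; last by rewrite ep0 eqxx.
by symmetry; apply: biclique_eq => //; rewrite inE in e00.
Qed.

(** Over a given pair of fibers, a biclique is determined by any point of either side, so each fiber
    size bounds their number. *)
Lemma card_bicliques : #|bicliques| <= B.
Proof.
apply: leq_trans G_le.
pose F a b := [set pq in edges | (rep pq.1 == a) && (rep pq.2 == b)].
apply: (@leq_trans #|\bigcup_(ab | G ab.1 ab.2) (biclique @: F ab.1 ab.2)|).
  apply/subset_leq_card/subsetP => K /imsetP[[p q] epq ->].
  apply/bigcupP; exists (rep p, rep q); first by rewrite inE in epq; exact: E_G.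
  by apply: imset_f; rewrite inE epq /= !eqxx.
apply: leq_trans (leq_card_bigcup _ _ _) _; apply: leq_sum => -[a b] _ /=.
rewrite leq_min; apply/andP; split.
  pose g p := if [pick q | E p q && (rep q == b)] is Some q then biclique (p, q)
              else (set0, set0).
  apply: leq_trans (leq_imset_card g [set p | rep p == a]).
  apply/subset_leq_card/subsetP => _ /imsetP[[p q] + ->].
  rewrite !inE => /and3P[/= epq ra /eqP rb]; apply/imsetP; exists p; rewrite ?inE //.
  rewrite /g; case: pickP => [q' /andP[epq' /eqP rq']|/(_ q)]; last first.
    by rewrite epq rb eqxx.
  by symmetry; apply: biclique_eq; rewrite ?rb.
pose g q := if [pick p | E p q && (rep p == a)] is Some p then biclique (p, q)
            else (set0, set0).
apply: leq_trans (leq_imset_card g [set p | rep p == b]).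
apply/subset_leq_card/subsetP => _ /imsetP[[p q] + ->].
rewrite !inE => /and3P[/= epq /eqP ra rb]; apply/imsetP; exists q; rewrite ?inE //.
rewrite /g; case: pickP => [p' /andP[ep'q /eqP rp']|/(_ p)]; last first.
  by rewrite epq ra eqxx.
by symmetry; apply: biclique_eq; rewrite ?ra.
Qed.

Theorem card_edges_le : #|edges| <= B + 8 * (#|T| * k).
Proof.
apply: (@leq_trans (\sum_(K in bicliques) #|K.1| * #|K.2|)).
  apply: (@leq_trans #|\bigcup_(K in bicliques) setX K.1 K.2|).
    apply/subset_leq_card/subsetP => -[p q] epq.
    apply/bigcupP; exists (biclique (p, q)); first exact: imset_f.
    by rewrite inE /= in epq; rewrite !inE /= !eqxx (E_sym q) epq.
  apply: leq_trans (leq_card_bigcup _ _ _) _.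
  by apply: leq_sum => K _; rewrite cardsX.
apply: (@leq_trans (\sum_(K in bicliques)
    (1 + 2 * #|offdiag K.1| + 2 * #|offdiag K.2|))).
  apply: leq_sum => K _.
  (* From [2ab <= a^2 + b^2] and [c^2 <= 1 + 2c(c - 1)]. *)
  have := card_offdiag K.1; have := card_offdiag K.2.
  move: #|K.1| #|K.2| #|offdiag K.1| #|offdiag K.2| => a b x y; clear; nia.
rewrite !big_split /= sum1_card big1_eq !addn0.
have -> : \sum_(K in bicliques) #|offdiag K.2| = \sum_(K in bicliques) #|offdiag K.1|.
  rewrite (reindex_inj (h := swap)) /=; last by move=> [? ?] [? ?] [-> ->].
  by apply: eq_bigl => K; exact: swap_bicliques.
have := sum_offdiag_le; have := card_bicliques.
move: #|bicliques| (\sum_(K in bicliques) #|offdiag K.1|) (#|T| * k) => x y m; clear; lia.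
Qed.

End Bicliques.

(** * The dual unit distance graph *)

Section DualUnitDistances.

Variables (R : rcfType) (T : finType) (a v : T -> R * R).
Hypothesis av_inj : forall p q, a p = a q -> v p = v q -> p = q.
Local Open Scope ring_scope.

(** Distance [[1, 0]] for points with real part [a] and imaginary part [v]; the factor 2 in the
    second component is dropped. *)
Definition dual_unit_apart p q := unit_apart (a p) (a q) &&
  (((a p).1 - (a q).1) * ((v p).1 - (v q).1) +
   ((a p).2 - (a q).2) * ((v p).2 - (v q).2) == 0).

(** Both vectors are orthogonal to [w], hence parallel, and Lagrange's identity gives their inner
    product square 1. *)
Lemma unit_perp_eq (x y x' y' w1 w2 : R) : (w1, w2) != (0, 0) ->
  x ^+ 2 + y ^+ 2 = 1 -> x' ^+ 2 + y' ^+ 2 = 1 ->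
  x * w1 + y * w2 = 0 -> x' * w1 + y' * w2 = 0 ->
  (x', y') = (x, y) \/ (x', y') = (- x, - y).
Proof.
move=> w0 u1 u1' pw pw'.
have cross : x * y' - y * x' = 0.
  have c1 : (x * y' - y * x') * w1 = 0.
    transitivity (y' * (x * w1 + y * w2) - y * (x' * w1 + y' * w2)); first by ring.
    by rewrite pw pw' !mulr0 subrr.
  have c2 : (x * y' - y * x') * w2 = 0.
    transitivity (x * (x' * w1 + y' * w2) - x' * (x * w1 + y * w2)); first by ring.
    by rewrite pw pw' !mulr0 subrr.
  apply/eqP; move: w0; rewrite xpair_eqE negb_and => /orP[] w0.
    by move/eqP: c1; rewrite mulf_eq0 (negbTE w0) orbF.
  by move/eqP: c2; rewrite mulf_eq0 (negbTE w0) orbF.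
have dot2 : (x * x' + y * y') ^+ 2 = 1.
  transitivity ((x ^+ 2 + y ^+ 2) * (x' ^+ 2 + y' ^+ 2) - (x * y' - y * x') ^+ 2).
    by ring.
  by rewrite u1 u1' cross; ring.
have sumsq0 (r t : R) : r ^+ 2 + t ^+ 2 = 0 -> r = 0 /\ t = 0.
  move/eqP; rewrite paddr_eq0 ?sqr_ge0 // !sqrf_eq0.
  by case/andP=> /eqP -> /eqP ->.
move/eqP: dot2; rewrite sqrf_eq1 => /orP[]/eqP dot; [left|right].
  have [|e1 e2] := sumsq0 (x' - x) (y' - y).
    transitivity ((x ^+ 2 + y ^+ 2) + (x' ^+ 2 + y' ^+ 2) - 2 * (x * x' + y * y')).
      by ring.
    by rewrite u1 u1' dot; ring.
  by congr pair; lra.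
have [|e1 e2] := sumsq0 (x' + x) (y' + y).
  transitivity ((x ^+ 2 + y ^+ 2) + (x' ^+ 2 + y' ^+ 2) + 2 * (x * x' + y * y')).
    by ring.
  by rewrite u1 u1' dot; ring.
by congr pair; lra.
Qed.

(** Subtracting the orthogonality conditions makes [a p - a q] a unit vector orthogonal to the
    nonzero [v p - v p'], which leaves two choices. *)
Lemma common_neighbours_two p p' : p != p' -> a p = a p' ->
  exists q1 q2, forall q, dual_unit_apart p q -> dual_unit_apart p' q ->
    a q = a q1 \/ a q = a q2.
Proof.
move=> npp' ap.
have w0 : ((v p).1 - (v p').1, (v p).2 - (v p').2) != (0, 0).
  apply: contra npp' => /eqP[/subr0_eq e1 /subr0_eq e2]; apply/eqP/av_inj => //.
  by case: (v p) (v p') e1 e2 => ? ? [? ?] /= -> ->.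
pose common := [pred q | dual_unit_apart p q && dual_unit_apart p' q].
case: (pickP common) => [q1 c1|no]; last first.
  by exists p, p => q e e'; have := no q; rewrite /= e e'.
case: (pickP [pred q | common q && (a q != a q1)]) => [q2 /andP[c2 n2]|no]; last first.
  by exists q1, q1 => q e e'; have := no q; rewrite /= e e' /= => /negbFE/eqP; left.
exists q1, q2 => q e e'.
have perp q' : common q' ->
    [/\ ((a p).1 - (a q').1) ^+ 2 + ((a p).2 - (a q').2) ^+ 2 = 1 &
     ((a p).1 - (a q').1) * ((v p).1 - (v p').1) +
     ((a p).2 - (a q').2) * ((v p).2 - (v p').2) = 0].
  case/andP=> /andP[/eqP e1 /eqP e2] /andP[_ /eqP]; rewrite -ap => e3; split=> //.
  by rewrite -[RHS](subrr 0) -{1}e2 -{1}e3; ring.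
have [u1 o1] := perp _ c1; have [u2 o2] := perp _ c2.
have [|u o] := perp q; first by rewrite /= e e'.
have aE q' q'' : (a p).1 - (a q').1 = (a p).1 - (a q'').1 ->
    (a p).2 - (a q').2 = (a p).2 - (a q'').2 -> a q' = a q''.
  by case: (a q') (a q'') => ? ? [? ?] /= ? ?; congr pair; lra.
case: (unit_perp_eq w0 u1 u o1 o) => -[e1 e2]; first by left; apply: aE.
case: (unit_perp_eq w0 u1 u2 o1 o2) => -[f1 f2].
  by case/eqP: n2; apply: aE.
by right; apply: aE; rewrite ?e1 ?e2.
Qed.

Theorem dual_unit_distances_le (k s : nat) :
  (forall p, #|[set q | a q == a p]| <= k)%N -> (4 <= s)%N -> (#|T| <= s ^ 3)%N ->
  (#|[set pq | dual_unit_apart pq.1 pq.2]| <=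
     80 * s * #|T| + 8 * (#|T| * k))%N.
Proof.
move=> fib s4 Ts.
pose rep p := odflt p [pick q | a q == a p].
have a_rep p : a (rep p) = a p.
  by rewrite /rep; case: pickP => [q /eqP|].
have repP p q : rep p = rep q <-> a p = a q.
  split=> [e|e]; first by rewrite -a_rep e a_rep.
  rewrite /rep (eq_pick (Q := fun x => a x == a q)) => [|x]; last by rewrite /= e.
  by case: pickP => // /(_ q); rewrite eqxx.
pose A := [set rep p | p in T].
have sumW : (\sum_(b in A) #|[set p | rep p == b]| = #|T|)%N.
  rewrite -[RHS]sum1_card [RHS](partition_big rep (fun b => b \in A)) /=; last first.
    by move=> p _; exact: imset_f.
  by apply: eq_bigr => b _; rewrite -sum1_card; apply: eq_bigl => p; rewrite inE.
apply: (@card_edges_le _ dual_unit_apart rep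
  (fun b c => [&& b \in A, c \in A & unit_apart (a b) (a c)])).
- move=> p q; rewrite /dual_unit_apart /unit_apart; by congr andb; congr eq_op; ring.
(* For fixed real parts the second condition is affine in the imaginary parts: its value at
   [(p', q')] is the sum of those at [(p, q')] and [(p', q)] minus that at [(p, q)]. *)
- move=> p p' q q' /repP ap /repP aq /andP[u /eqP e1] /andP[_ /eqP e2] /andP[_ /eqP e3].
  apply/andP; rewrite -ap -aq in e1 e2 e3 *; split=> //; apply/eqP.
  by rewrite -[RHS](subrr 0) -[X in _ = X - _](addr0 0) -{1}e2 -{1}e3 -{1}e1; ring.
- move=> p p' npp' /repP ap.
  have [q1 [q2 q12]] := common_neighbours_two npp' ap.
  exists (rep q1), (rep q2) => q e e'.
  by case: (q12 q e e') => /repP; [left | right].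
- move=> b; have [->|[p]] := set_0Vmem [set p | rep p == b]; first by rewrite cards0.
  rewrite inE => /eqP <-; apply: leq_trans (fib p); apply: eq_leq.
  by apply: eq_card => q; rewrite !inE; apply/eqP/eqP => /repP.
- move=> p q /andP[u _]; rewrite !a_rep u andbT; apply/andP; split; exact: imset_f.
have := @unit_distances_weighted_le _ _ a A (fun b => #|[set p | rep p == b]|) s.
rewrite sumW; apply=> //.
by move=> _ _ /imsetP[p _ ->] /imsetP[q _ ->]; rewrite !a_rep => /repP.
Qed.

End DualUnitDistances.

Local Open Scope ring_scope.

(** * Dilations of the dual plane and extremal numbers *)

Section DualPlane.

Variable R : realType.
Implicit Types (d : dual_number R) (P : {fset dual_plane R}).

Definition dual_dilate (s : dual_number R) (p : dual_plane R) : dual_plane R := (s * p.1, s * p.2).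

Lemma rho_dilate s p q : rho (dual_dilate s p) (dual_dilate s q) = s ^+ 2 * rho p q.
Proof. by rewrite /rho /=; ring. Qed.

Lemma dual_dilateK s t : t * s = 1 -> cancel (dual_dilate s) (dual_dilate t).
Proof. by move=> ts [x y]; rewrite /dual_dilate /= !mulrA ts !mul1r. Qed.

Definition imag_part (p : dual_plane R) := (deps p.1, deps p.2).

Lemma dual_plane_ext (p q : dual_plane R) :
  real_part p = real_part q -> imag_part p = imag_part q -> p = q.
Proof.
by case: p q => [[x y] [z w]] [[x' y'] [z' w']] [/= -> ->] [/= -> ->].
Qed.

Lemma dual_sqrt_exists d : 0 < dre d ->
  exists s t, [/\ s ^+ 2 = d, t * s = 1 & dre t != 0].
Proof.
case: d => d1 d2 /= d1_gt0; pose r := Num.sqrt d1.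
have r_gt0 : 0 < r by rewrite sqrtr_gt0.
have r2 : r ^+ 2 = d1 by rewrite sqr_sqrtr // ltW.
have r_neq0 : r != 0 by rewrite gt_eqF.
(* The root [r + y eps] solves [r^2 = d1] and [2 r y = d2]; its inverse is [1/r - (y/r^2) eps]. *)
exists (Dual r (d2 / (2 * r))), (Dual r^-1 (- (d2 / (2 * r)) / r ^+ 2)); split.
- rewrite expr2; congr Dual => /=; first by rewrite -r2 expr2.
  by field.
- by congr Dual => /=; field.
- by rewrite /= invr_eq0.
Qed.

Lemma card_dist_pairs_image (f : dual_plane R -> dual_plane R) d d' P :
  injective f -> (forall p q, (rho (f p) (f q) == d') = (rho p q == d)) ->
  #|` dist_pairs d' (f @` P)%fset| = #|` dist_pairs d P|.
Proof.
move=> f_inj fE; pose F (S : {fset dual_plane R}) := (f @` S)%fset.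
have F_inj : injective F.
  move=> S S' /fsetP eqF; apply/fsetP => x.
  by have := eqF (f x); rewrite !mem_imfset.
have F2 p q : F [fset p; q]%fset = [fset f p; f q]%fset by rewrite /F imfset_fset2.
have -> : dist_pairs d' (f @` P)%fset = (F @` dist_pairs d P)%fset; last first.
  by rewrite card_imfset.
apply/fsetP => S.
apply/imfsetP/imfsetP => /=.
  case=> -[x y] /=; rewrite inE in_fsetM /=.
  move=> /andP[/andP[/imfsetP[/= p pP ->] /imfsetP[/= q qP ->]]].
  rewrite fE => pq ->; exists [fset p; q]%fset; last by rewrite F2.
  by apply/imfsetP; exists (p, q); rewrite //= inE in_fsetM /= pP qP.
case=> _ /imfsetP[[p q] /= + ->]; rewrite inE in_fsetM /= => /andP[/andP[pP qP] pq] ->.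
exists (f p, f q); last by rewrite /= F2.
by rewrite inE in_fsetM /= !mem_imfset // pP qP fE.
Qed.

Lemma card_dist_pairs_le d P :
  (#|` dist_pairs d P| <= #|[set pq : P * P | rho (val pq.1) (val pq.2) == d]|)%N.
Proof.
pose g (pq : P * P) := [fset val pq.1; val pq.2]%fset.
apply: (@leq_trans #|` [fset g pq | pq in [set pq : P * P | rho (val pq.1) (val pq.2) == d]]%fset|).
  apply/fsubset_leq_card/fsubsetP => _ /imfsetP[[p q] /= + ->].
  rewrite inE in_fsetM /= => /andP[/andP[pP qP] pq].
  by apply/imfsetP; exists ([` pP]%fset, [` qP]%fset); rewrite //= inE.
by apply: leq_trans (leq_imfset_card _ _ _) _; rewrite /= cardE.
Qed.

(** [f] carries an extremal set forward, and [g] carries every competitor back. *)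
Lemma is_max_pairs_dilate (f g : dual_plane R -> dual_plane R) d d' n m :
  cancel f g -> cancel g f ->
  (forall p q, (rho (f p) (f q) == d') = (rho p q == d)) ->
  is_max_pairs n d m -> is_max_pairs n d' m.
Proof.
move=> fK gK fE [[P [Pn Pm]] max]; split.
  exists (f @` P)%fset; split; first by rewrite card_imfset //; exact: can_inj fK.
  by rewrite (card_dist_pairs_image (d := d)) //; exact: can_inj fK.
move=> Q Qn; rewrite -(card_dist_pairs_image (f := g) (d' := d)) //; last first.
- by move=> p q; rewrite -fE !gK.
- exact: can_inj gK.
by apply: max; rewrite card_imfset //; exact: can_inj gK.
Qed.

(** Sets of [n] points exist and their counts are at most [n^2], so a maximum is attained. *)
Lemma max_pairs_exists n d : exists m, is_max_pairs n d m.
Proof.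
pose S m := `[< exists P, #|` P| = n /\ #|` dist_pairs d P| = m >].
have S_ex : exists m, S m.
  pose f i : dual_plane R := (i%:R, 0).
  pose P : {fset dual_plane R} := [fset x in [seq f i | i <- iota 0 n]]%fset.
  exists #|` dist_pairs d P|; apply/asboolP; exists P; split=> //.
  rewrite card_fseq undup_id ?size_map ?size_iota // map_inj_uniq ?iota_uniq //.
  move=> i j [/(congr1 (@dre R))].
  have dre_nat k : dre (k%:R : dual_number R) = k%:R.
    by elim: k => // k IH; rewrite !mulrS /= -IH.
  by rewrite !dre_nat => /eqP; rewrite eqr_nat => /eqP.
have S_ub m : S m -> (m <= n * n)%N.
  move=> /asboolP[P [Pn <-]]; apply: leq_trans (card_dist_pairs_le _ _) _.
  by apply: leq_trans (max_card _) _; rewrite card_prod -cardfE Pn.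
case: (ex_maxnP S_ex S_ub) => m /asboolP Sm max.
by exists m; split=> // P Pn; apply: max; apply/asboolP; exists P.
Qed.

Lemma fiber_le_multiplicity P (u : R * R) :
  (#|[set p : P | real_part (val p) == u]| <= multiplicity P)%N.
Proof.
pose S := [fset p in P | real_part p == u]%fset.
apply: (@leq_trans #|` S|).
  rewrite cardE -(size_map val); apply: uniq_leq_size.
    by rewrite map_inj_uniq ?enum_uniq //; exact: val_inj.
  by move=> _ /mapP[p + ->]; rewrite mem_enum inE => pu; rewrite !inE pu (valP p).
apply: (bigmaxn_sup_seq S) => //.
  by rewrite fpowersetE; apply/fsubsetP => x; rewrite !inE => /andP[].
apply: (@all_pred1_constant _ u); rewrite all_map; apply/allP => x /=.
by rewrite !inE => /andP[].
Qed.

(** Dividing by a square root of [d] turns the distance into [[1, 0]]. Real parts are multiplied by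
    [dre t != 0], so fibers correspond to fibers. *)
Lemma dist_pairs_le d P s : 0 < dre d ->
  (4 <= s)%N -> (#|` P| <= s ^ 3)%N ->
  (#|` dist_pairs d P| <= 80 * s * #|` P| + 8 * (#|` P| * multiplicity P))%N.
Proof.
move=> d_gt0 s4 Ps; apply: leq_trans (card_dist_pairs_le _ _) _.
have [r [t [r2 tr t0]]] := dual_sqrt_exists d_gt0.
pose a (p : P) := real_part (dual_dilate t (val p)).
pose v (p : P) := imag_part (dual_dilate t (val p)).
have rt : r * t = 1 by rewrite mulrC.
have av_inj p q : a p = a q -> v p = v q -> p = q.
  move=> apq vpq; apply/val_inj/(can_inj (dual_dilateK rt)).
  exact: dual_plane_ext.
rewrite cardfE in Ps *.
apply: leq_trans (dual_unit_distances_le av_inj _ s4 Ps) => [|p]; last first.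
  apply: leq_trans (fiber_le_multiplicity P (real_part (val p))).
  apply/subset_leq_card/subsetP => q; rewrite !inE => /eqP[].
  rewrite /real_part => /(mulfI t0) -> /(mulfI t0) ->; exact: eqxx.
apply/subset_leq_card/subsetP => -[p q]; rewrite !inE /= => /eqP pq.
have : rho (dual_dilate t (val p)) (dual_dilate t (val q)) = Dual 1 0.
  by rewrite rho_dilate pq -r2 -exprMn tr expr1n.
rewrite /dual_unit_apart /unit_apart /a /v.
case: (dual_dilate t (val p)) (dual_dilate t (val q)) => [[x y] [z w]] [[x' y'] [z' w']] /=.
rewrite rhoE /= => -[-> /eqP]; rewrite mulf_eq0 pnatr_eq0 /= => ->.
by rewrite eqxx.
Qed.

Lemma dist_pairs_powR_le d P (n : nat) (lambda : R) : 0 < dre d -> (0 < n)%N ->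
  #|` P| = n -> (multiplicity P)%:R = n%:R `^ lambda ->
  (#|` dist_pairs d P|)%:R <=
    640 * n%:R `^ (4 / 3) + 8 * n%:R `^ (1 + lambda).
Proof.
move=> d_gt0 n_gt0 Pn mult.
have n0 : n%:R != 0 :> R by rewrite pnatr_eq0; lia.
have n1 : 1 <= n%:R :> R by rewrite ler1n.
pose c : R := n%:R `^ (3^-1).
have c3 : c ^+ 3 = n%:R.
  by rewrite -powR_mulrn ?powR_ge0 // -powRrM mulVf ?pnatr_eq0 // powRr1 // ler0n.
have c1 : 1 <= c.
  by rewrite -(powRr0 (n%:R : R)) /c ler_powR // invr_ge0.
(* This gives [s >= 4], [s^3 >= n] and, as [c >= 1], also [s <= 8 c]; hence [640 = 80 * 8]. *)
pose s := (4 * (Num.trunc c).+1)%N.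
have s3 : (#|` P| <= s ^ 3)%N.
  rewrite Pn -(ler_nat R) -c3 natrX lerXn2r ?nnegrE ?ler0n ?powR_ge0 //.
  apply: ltW; apply: lt_le_trans (truncnS_gt c) _; by rewrite ler_nat leq_pmull.
have s_le : s%:R <= 8 * c.
  have : (Num.trunc c)%:R <= c by rewrite truncn_le; lra.
  by rewrite /s natrM -natr1; lra.
have s4 : (4 <= s)%N by rewrite /s; lia.
clearbody s; have := dist_pairs_le d_gt0 s4 s3; rewrite Pn -(ler_nat R).
rewrite natrD !natrM mult => /le_trans; apply; apply: lerD.
  have -> : n%:R `^ (4 / 3) = c * n%:R :> R.
    rewrite (_ : 4 / 3 = 3^-1 + 1); last by field.
    by rewrite powRD ?n0 ?implybT // powRr1 ?ler0n.
  have : 0 <= (8 * c - s%:R) * n%:R by rewrite mulr_ge0 ?ler0n // subr_ge0.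
  by move: (s%:R) (n%:R : R) => ? ?; lra.
by rewrite powRD ?n0 ?implybT // powRr1 ?ler0n.
Qed.

End DualPlane.

Theorem claim3p1 (R : realType) :
  (forall (delta : dual_number R), 0 < dre delta ->
   forall n : nat, (1 <= n)%N ->
     exists m : nat,
       is_max_pairs n (Dual 1 0 : dual_number R) m /\ is_max_pairs n delta m)
  /\
  (exists C : R,
   forall (delta : dual_number R), 0 < dre delta ->
   forall lambda : R, 0 <= lambda <= 1 ->
   forall (n : nat) (P : {fset dual_plane R}),
     (1 <= n)%N -> #|` P| = n ->
     (multiplicity P)%:R = n%:R `^ lambda ->
     (#|` dist_pairs delta P|)%:R <=
       C * (n%:R `^ (1 + lambda) * ln n%:R ^+ 4
            + n%:R `^ (4 / 3) * ln n%:R ^+ 2)).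
Proof.
split=> [delta delta_gt0 n _|].
  have [s [t [s2 ts _]]] := dual_sqrt_exists delta_gt0.
  have st : s * t = 1 by rewrite mulrC.
  have [m max_m] := max_pairs_exists n (Dual 1 0 : dual_number R).
  exists m; split=> //.
  apply: is_max_pairs_dilate (dual_dilateK ts) (dual_dilateK st) _ max_m.
  move=> p q; rewrite rho_dilate s2; apply/eqP/eqP => [e|->]; last by rewrite mulr1.
  by rewrite -[LHS]mul1r -(expr1n _ 2) -ts exprMn -mulrA s2 e -s2 -exprMn ts expr1n.
pose l : R := ln 2; have l_gt0 : 0 < l by rewrite ln_gt0 // ltr1n.
(* The bound obtained has no logarithms; for [n >= 2] they are at least [l], and the denominators
   compensate for them. *)
exists (8 / l ^+ 4 + 640 / l ^+ 2) => delta delta_gt0 lambda _ n P n_gt0 Pn mult.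
(* For [n = 1] the right side vanishes with [ln 1], so the count must be exactly 0: a point has
   distance 0 from itself. *)
have [n1|n2] := leqP n 1.
  have [x Px] : exists x, P = [fset x]%fset by apply/cardfs1P/eqP; lia.
  suff -> : dist_pairs delta P = fset0.
    have ln_n_ge0 : 0 <= ln n%:R :> R by rewrite ln_ge0 // ler1n.
    have ln_pow_ge0 k : 0 <= ln n%:R ^+ k :> R by exact: exprn_ge0.
    have l_pow_ge0 k : 0 <= l ^+ k by apply/exprn_ge0/ltW.
    rewrite cardfs0; apply: mulr_ge0; apply: addr_ge0; first 2 last.
    - by apply: mulr_ge0; rewrite ?powR_ge0.
    - by apply: mulr_ge0; rewrite ?powR_ge0.
    - by rewrite divr_ge0 ?ler0n.
    - by rewrite divr_ge0 ?ler0n.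
  apply/fsetP => S; rewrite inE; apply/negP => /imfsetP[[p q] /= + _].
  rewrite inE in_fsetM Px !inE /= => /andP[/andP[/eqP -> /eqP ->]].
  rewrite /rho !subrr expr0n addr0 => /eqP d0.
  by move: delta_gt0; rewrite -d0 ltxx.
apply: le_trans (dist_pairs_powR_le delta_gt0 n_gt0 Pn mult) _.
have ln_le : l <= ln n%:R by rewrite ler_ln ?posrE ?ltr0n // ler_nat.
have q4 : 1 <= ln n%:R ^+ 4 / l ^+ 4.
  by rewrite ler_pdivlMr ?exprn_gt0 // mul1r lerXn2r ?nnegrE //; lra.
have q2 : 1 <= ln n%:R ^+ 2 / l ^+ 2.
  by rewrite ler_pdivlMr ?exprn_gt0 // mul1r lerXn2r ?nnegrE //; lra.
have u_ge0 : 0 <= n%:R `^ (1 + lambda) by exact: powR_ge0.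
have v_ge0 : 0 <= n%:R `^ (4 / 3) :> R by exact: powR_ge0.
move: (n%:R `^ (1 + lambda)) (n%:R `^ (4 / 3)) u_ge0 v_ge0 => u v u_ge0 v_ge0.
have a4 : 0 <= (l ^+ 4)^-1 by rewrite invr_ge0 exprn_ge0 // ltW.
have a2 : 0 <= (l ^+ 2)^-1 by rewrite invr_ge0 exprn_ge0 // ltW.
have b4 : 0 <= ln n%:R ^+ 4 :> R by rewrite exprn_ge0 //; lra.
have b2 : 0 <= ln n%:R ^+ 2 :> R by rewrite exprn_ge0 //; lra.
move: q4 q2 a4 a2 b4 b2.
move: (ln n%:R ^+ 4) (ln n%:R ^+ 2) (l ^+ 4)^-1 (l ^+ 2)^-1 => L4 L2 i4 i2 q4 q2 a4 a2 b4 b2.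
have := ler_wpM2l u_ge0 q4; have := ler_wpM2l v_ge0 q2.
have := mulr_ge0 (mulr_ge0 a4 v_ge0) b2; have := mulr_ge0 (mulr_ge0 a2 u_ge0) b4.
lra.
Qed.
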